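(* Let $d$ be a fixed dimension. There exists a deterministic one-pass streaming algorithm that, given a convex polyhedron $\mathcal{K}$ in $\mathbb{R}^d$ as a stream of $n$ hyperplanes and a query point $q$ (given at the end of the stream) whose distance to the boundary of $\mathcal{K}$ is at least $\epsilon$, solves GEOM-QUERY-CONV-POLY, i.e. correctly decides whether $q \in \mathcal{K}$, by storing $O\left(\frac{\log^d n}{\epsilon^{(d-1)/2}}\right)$ facets.
   Context: GEOM-QUERY-CONV-POLY: a convex polyhedron $\mathcal{K}$ in $\mathbb{R}^d$ is given as a stream of at most $n$ hyperplanes ($\mathcal{K}$ is the intersection of the corresponding half-spaces), and after the stream a query point $q \in \mathbb{R}^d$ is given; decide whether $q\in\mathcal{K}$. $\mathcal{K}$ is contained in a unit ball (diameter bounded by $1$). A one-pass (insertion-only) streaming algorithm reads the hyperplanes once in order and keeps only a sketch in memory; here the sketch is measured by the number of facets (hyperplane descriptions) stored. Distance is Euclidean. *)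

(* Defs.v *)
From HB Require Import structures.
From mathcomp Require Import all_boot all_order all_algebra.
From mathcomp Require Import all_classical all_reals all_analysis.
Set Implicit Arguments.
Unset Strict Implicit.
Unset Printing Implicit Defensive.
Import Order.TTheory GRing.Theory Num.Theory.
Import numFieldNormedType.Exports.
Local Open Scope classical_set_scope.
Local Open Scope ring_scope.

(* MathComp-Analysis; R^d is 'rV[R]_d. *)

Definition dotp (R : realType) (d : nat) (x y : 'rV[R]_d) : R :=
  \sum_(i < d) x 0 i * y 0 i.

(* The library norm `|x| on 'rV[R]_d is the sup norm, which induces the same
   topology but not the Euclidean distance. *)
Definition enorm (R : realType) (d : nat) (x : 'rV[R]_d) : R :=
  Num.sqrt (dotp x x).

(* A hyperplane description is a pair (a, b) with a <> 0; it stands for the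
   hyperplane a.x = b together with the choice of the side a.x <= b. *)
Definition hyperplane (R : realType) (d : nat) : Type :=
  {h : 'rV[R]_d * R | h.1 != 0}.

HB.instance Definition _ (R : realType) (d : nat) :=
  Choice.on (hyperplane R d).

Definition halfspace (R : realType) (d : nat) (h : hyperplane R d) :
  set 'rV[R]_d := [set x | dotp (val h).1 x <= (val h).2].

Definition polyhedron (R : realType) (d : nat) (s : seq (hyperplane R d)) :
  set 'rV[R]_d := [set x | forall h, h \in s -> halfspace h x].

Definition boundary (R : realType) (d : nat) (K : set 'rV[R]_d) :
  set 'rV[R]_d := closure K `\` interior K.

(* Extended-real valued, so that the distance to an empty set is +oo. *)
Definition edistance (R : realType) (d : nat) (q : 'rV[R]_d)
  (B : set 'rV[R]_d) : \bar R :=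
  ereal_inf [set (enorm (q - y))%:E | y in B].

Definition unit_ball (R : realType) (d : nat) (c : 'rV[R]_d) :
  set 'rV[R]_d := [set x | enorm (x - c) <= 1].

(* A deterministic one-pass algorithm whose memory is a list of facets.
   [update t S h] is the memory after reading h, when t items were read before
   and S was in memory; [answer t S q] is the answer to the query q once t
   items have been read. The clock t is the only thing available beside S.
   Memory is counted in facets, and a real coordinate could encode a whole
   stream; [update_sub] rules this out by requiring every stored facet to be
   a hyperplane of the stream. Repetitions in the list are counted. *)
Record streaming_algorithm (R : realType) (d : nat) := StreamingAlgorithm {
  update : nat -> seq (hyperplane R d) -> hyperplane R d ->
           seq (hyperplane R d);
  answer : nat -> seq (hyperplane R d) -> 'rV[R]_d -> bool;
  update_sub : forall t S h, {subset update t S h <= h :: S}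
}.

Definition memory (R : realType) (d : nat) (A : streaming_algorithm R d)
  (s : seq (hyperplane R d)) : seq (hyperplane R d) :=
  (foldl (fun st h => (st.1.+1, update A st.1 st.2 h)) (0%N, [::]) s).2.

Definition output (R : realType) (d : nat) (A : streaming_algorithm R d)
  (s : seq (hyperplane R d)) (q : 'rV[R]_d) : bool :=
  answer A (size s) (memory A s) q.

(* Main.v *)
(* Scale every half-space so that its normal has sup norm 1, with a given
   dominant coordinate equal to +1 or -1; it becomes a pair (m, b) of a slope in
   [-1, 1]^(d-1) and an offset, and q violates it when m.q - b exceeds a known
   quantity. For each point y of a grid of mesh O(sqrt eps) in [-2, 2]^(d-1),
   keep the half-space seen so far that minimizes b + |m - y|^2 / 2. If q
   violates (m, b) and y is within distance r of m + q, the half-space kept for y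
   is, up to r^2 / 2 <= eps, violated at least as much by q. Hence it suffices to
   accept q exactly when the ball of radius eps around q satisfies all kept
   half-spaces. The minima are maintained exactly, so no error accumulates along
   the stream and O(eps^(-(d-1)/2)) half-spaces are enough. *)

Require Import Defs.
From HB Require Import structures.
From mathcomp Require Import all_boot all_order all_algebra.
From mathcomp Require Import all_classical all_reals all_analysis.
From mathcomp Require Import ring lra.
Import Order.TTheory GRing.Theory Num.Theory.
Import numFieldNormedType.Exports.
Local Open Scope classical_set_scope.
Local Open Scope ring_scope.

(** * Euclidean geometry: distance to the boundary and depth inside half-spaces *)

Section Euclidean.
Context {R : realType} {d : nat}.
Implicit Types (a x y z : 'rV[R]_d).

Lemma dotpDr a x y : dotp a (x + y) = dotp a x + dotp a y.
Proof. by rewrite /dotp -big_split; apply: eq_bigr => i _; rewrite mxE mulrDr. Qed.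

Lemma dotpZr (k : R) a x : dotp a (k *: x) = k * dotp a x.
Proof. by rewrite /dotp mulr_sumr; apply: eq_bigr => i _; rewrite mxE mulrCA. Qed.

Lemma dotpC x y : dotp x y = dotp y x.
Proof. by apply: eq_bigr => i _; rewrite mulrC. Qed.

Lemma dotpBr a x y : dotp a (x - y) = dotp a x - dotp a y.
Proof. by rewrite -scaleN1r dotpDr dotpZr mulN1r. Qed.

Lemma dotpp_ge0 x : 0 <= dotp x x.
Proof. by apply: sumr_ge0 => i _; rewrite -expr2 sqr_ge0. Qed.

Lemma enorm_ge0 x : 0 <= enorm x.
Proof. exact: sqrtr_ge0. Qed.

Lemma sqr_enorm x : enorm x ^+ 2 = dotp x x.
Proof. by rewrite sqr_sqrtr ?dotpp_ge0. Qed.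

Lemma enormZ (k : R) x : enorm (k *: x) = `|k| * enorm x.
Proof.
by rewrite /enorm dotpZr dotpC dotpZr mulrA -expr2 sqrtrM ?sqr_ge0// sqrtr_sqr.
Qed.

Lemma enormN x : enorm (- x) = enorm x.
Proof. by rewrite -scaleN1r enormZ normrN1 mul1r. Qed.

Lemma coord_le_enorm x i : `|x 0 i| <= enorm x.
Proof.
rewrite -sqrtr_sqr ler_wsqrtr// /dotp (bigD1 i)//= -expr2 lerDl.
by apply: sumr_ge0 => j _; rewrite -expr2 sqr_ge0.
Qed.

Lemma enorm_gt0 x : x != 0 -> 0 < enorm x.
Proof.
move=> /rV0Pn[i xi0]; apply: lt_le_trans (coord_le_enorm x i).
by rewrite normr_gt0.
Qed.

(** Cut the segment from [q] to [z] at the supremum of the parameters whose points lie in [K].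
    Points of [K] approach the cut; were it interior, the supremum could grow or [z] would be in
    [K]. *)
Lemma boundary_segment (K : set 'rV[R]_d) q z : K q -> ~ K z ->
  exists2 y, boundary K y & enorm (q - y) <= enorm (q - z).
Proof.
move=> Kq Kz; pose g (t : R) := q + t *: (z - q).
have gcont : continuous g.
  by move=> t; apply: cvgD; [exact: cvg_cst|apply: cvgZr_tmp; exact: cvg_id].
pose E := [set t : R | 0 <= t <= 1 /\ K (g t)].
have E0 : E 0 by split; rewrite ?lexx ?ler01// /g scale0r addr0.
have Eub : has_ubound E by exists 1 => t [/andP[]].
have Esup : has_sup E by split; first by exists 0.
have s0 : 0 <= sup E by exact: ub_le_sup.
have s1 : sup E <= 1 by apply: ge_sup; [exists 0|move=> t [/andP[]]].
exists (g (sup E)); last first.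
  have -> : q - g (sup E) = sup E *: (q - z).
    by rewrite /g -[q - z]opprB scalerN opprD addrA subrr add0r.
  by rewrite enormZ ger0_norm// ler_piMl ?enorm_ge0.
split.
  move=> B /gcont /nbhs_ballP[e /= e0 eB].
  have [t Et lt] := sup_adherent e0 Esup.
  exists (g t); split; first by case: Et.
  apply: eB; rewrite /ball/= ger0_norm ?subr_ge0; last exact: ub_le_sup.
  by rewrite ltrBlDr -ltrBlDl.
move=> /gcont /nbhs_ballP[e /= e0 eK].
have [s_lt1|s_ge1] := ltP (sup E) 1; last first.
  apply: Kz; have -> : z = g (sup E).
    by rewrite /g (_ : sup E = 1) ?scale1r 1?addrC ?subrK//; apply/le_anti/andP.
  by apply: eK; exact: ballxx.
pose t := Num.min (sup E + e / 2) 1.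
have st : sup E < t by rewrite lt_min s_lt1 ltrDl divr_gt0.
have : t <= sup E.
  apply: ub_le_sup => //; split.
    by rewrite (le_trans s0 (ltW st))/= ge_min lexx orbT.
  apply: eK; rewrite /ball/= distrC gtr0_norm ?subr_gt0//.
  rewrite ltrBlDl; apply: (@le_lt_trans _ _ (sup E + e / 2)).
    by rewrite ge_min lexx.
  by rewrite ltrD2l; lra.
by rewrite leNgt st.
Qed.

Lemma edistance_boundary_ge (K : set 'rV[R]_d) q (e : R) z :
  (e%:E <= edistance q (boundary K))%E -> K q -> enorm (q - z) < e -> K z.
Proof.
move=> eK Kq qz; apply: contrapT => /(boundary_segment _ _ _ Kq)[y By yz].
have : (e%:E <= (enorm (q - y))%:E)%E.
  by apply: le_trans eK _; apply: ereal_inf_lbound; exists y.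
by rewrite lee_fin leNgt (le_lt_trans yz qz).
Qed.

Lemma halfspace_deep (h : hyperplane R d) q (e : R) : 0 < e ->
  (forall z, enorm (q - z) < e -> halfspace h z) ->
  dotp (val h).1 q + e * enorm (val h).1 <= (val h).2.
Proof.
set a := (val h).1 => e0 qh.
have a0 : 0 < enorm a by apply: enorm_gt0; exact: (valP h).
apply/ler_addgt0Pl => r r0; rewrite leNgt; apply/negP => lt_r.
(* The ball is open, so its extremal point in direction [a] is out of reach; the slack [r] pays for
   a step shorter than [e], and the maximum with 0 covers large [r]. *)
pose t := Num.max 0 (e - r / enorm a).
have t0 : 0 <= t by rewrite le_max lexx.
have te : t < e by rewrite gt_max e0/= ltrBlDr ltrDl divr_gt0.
have : halfspace h (q + (t / enorm a) *: a).
  apply: qh; rewrite opprD addrA subrr add0r enormN enormZ ger0_norm.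
    by rewrite divfK ?gt_eqF.
  by rewrite divr_ge0 // ltW.
rewrite /halfspace/= -/a dotpDr dotpZr -sqr_enorm expr2 mulrA divfK ?gt_eqF//.
apply/negP; rewrite -ltNge.
have : (e - r / enorm a) * enorm a <= t * enorm a.
  by rewrite ler_pM2r// le_max lexx orbT.
by rewrite mulrBl divfK ?gt_eqF//; lra.
Qed.

End Euclidean.

Lemma has_argmin {R : realType} {T : eqType} (f : T -> R) (P : pred T)
    (s : seq T) x : x \in s -> P x ->
  exists2 y, y \in s & P y && all (fun z => P z ==> (f y <= f z)) s.
Proof.
elim: s x => // a s IHs x; have [|/hasPn sP] := boolP (has P s).
  move=> /hasP[b bs Pb] _ _; have [y ys /andP[Py ymin]] := IHs b bs Pb.
  have [aP|] := boolP (P a && (f a < f y)).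
    move: aP => /andP[Pa ay]; exists a; rewrite ?mem_head//= Pa lexx/=.
    apply: sub_all ymin => z /implyP zP; apply/implyP => /zP.
    exact/le_trans/ltW.
  rewrite negb_and -implybE -leNgt => ya.
  by exists y; rewrite ?in_cons ?ys ?orbT// Py/= ya.
move=> xs Px; move: xs; rewrite in_cons => /orP[/eqP <-|/sP]; last by rewrite Px.
exists x; rewrite ?mem_head//= Px lexx/=.
by apply/allP => z /sP /negPf ->.
Qed.

(** * The sketch: one cheapest half-space per nonempty cell *)

Section Sketch.
Context {R : realType} {d N : nat}.
Context (c : 'rV[R]_d.+1).
Implicit Types (h : hyperplane R d.+1) (L : seq (hyperplane R d.+1)).

(* The dominant coordinate of the normal vector, the sign of that coordinate,
   and a point of the grid in the space of the other d coordinates. *)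
Definition cell : finType := ('I_d.+1 * bool * {ffun 'I_d -> 'I_N.+1})%type.
Implicit Types k : cell.

Definition scale k h : R := (-1) ^+ k.1.2 * (val h).1 0 k.1.1.

(** A half-space competes at every grid point, because the relevant one depends on the query, known
    only after the stream. *)
Definition in_cell k h : bool :=
  [forall j, `|(val h).1 0 j| <= scale k h].

Definition slope k h (j : 'I_d.+1) : R := (val h).1 0 j / scale k h.

Definition offset k h : R := ((val h).2 - dotp (val h).1 c) / scale k h.

(** Mesh [4 / N] on [-2, 2], the range of a slope plus a coordinate of [q - c], both in [-1, 1]. *)
Definition grid (m : 'I_N.+1) : R := m%:R * (4 / N%:R) - 2.

Definition cost k h : R :=
  offset k h + (\sum_j (slope k h (lift k.1.1 j) - grid (k.2 j)) ^+ 2) / 2.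

Definition cheapest k L : seq (hyperplane R d.+1) :=
  [seq h <- L | in_cell k h &&
     all (fun h' => in_cell k h' ==> (cost k h <= cost k h')) L].

Definition sketch L : seq (hyperplane R d.+1) :=
  pmap (fun k => ohead (cheapest k L)) (enum cell).

Lemma sketch_sub L : {subset sketch L <= L}.
Proof.
move=> h; rewrite mem_pmap => /mapP[k _].
have : {subset cheapest k L <= L} by move=> h'; rewrite mem_filter => /andP[].
case: (cheapest k L) => // h' s sub [->]; exact/sub/mem_head.
Qed.

Lemma size_sketch L : (size (sketch L) <= d.+1 * 2 * N.+1 ^ d)%N.
Proof.
rewrite size_pmap (leq_trans (count_size _ _))// size_map -enumT -cardT.
by rewrite !card_prod card_bool card_ffun !card_ord.
Qed.

Lemma sketch_min k h L : h \in L -> in_cell k h ->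
  exists2 h', h' \in sketch L & in_cell k h' /\ cost k h' <= cost k h.
Proof.
move=> hL kh; have [y yL yP] := has_argmin (cost k) (in_cell k) L h hL kh.
have : y \in cheapest k L by rewrite mem_filter yP yL.
case E : (cheapest k L) => [//|h' s] _; exists h'.
  by rewrite mem_pmap; apply/mapP; exists k; rewrite ?mem_enum// E.
have : h' \in cheapest k L by rewrite E mem_head.
rewrite mem_filter => /andP[/andP[kh' /allP/(_ h hL)]].
by rewrite kh => /= ->.
Qed.

Lemma scale_gt0 k h : in_cell k h -> 0 < scale k h.
Proof.
move=> /forallP kh; have /rV0Pn[j hj] := valP h.
by apply: lt_le_trans (kh j); rewrite normr_gt0.
Qed.

Lemma in_cell_exists h : exists i b, forall f, in_cell ((i, b), f) h.
Proof.
pose i := [arg max_(i > ord0) `|(val h).1 0 i|]%O.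
exists i, ((val h).1 0 i < 0) => f; apply/forallP => j.
rewrite /scale/= -normrEsign ?num_real//.
by rewrite /i; case: arg_maxP => // i' _; exact.
Qed.

(** All half-spaces of a cell share this slope, so the dominant coordinate cancels when their
    excesses are compared, and a grid in the other [d] coordinates suffices. *)
Lemma slope_dominant k h : in_cell k h -> slope k h k.1.1 = (-1) ^+ k.1.2.
Proof.
move=> /scale_gt0; rewrite /slope /scale; case: k.1.2 => /=; rewrite ?mul1r.
  by rewrite mulN1r => ?; rewrite invrN mulrN divff// -oppr_eq0 gt_eqF.
by move=> ?; rewrite divff// gt_eqF.
Qed.

Lemma slope_le1 k h j : in_cell k h -> `|slope k h j| <= 1.
Proof.
move=> kh; have s0 := scale_gt0 _ _ kh.
rewrite normrM normfV (gtr0_norm s0) ler_pdivrMr// mul1r.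
by move/forallP: kh.
Qed.

Lemma scale_le_enorm k h : in_cell k h -> scale k h <= enorm (val h).1.
Proof.
move=> kh; rewrite -[leLHS](gtr0_norm (scale_gt0 _ _ kh)) normrM normr_sign.
by rewrite mul1r coord_le_enorm.
Qed.

Definition excess k h (q : 'rV[R]_d.+1) : R :=
  \sum_j slope k h j * (q - c) 0 j - offset k h.

Lemma excessE k h q : in_cell k h ->
  excess k h q = (dotp (val h).1 q - (val h).2) / scale k h.
Proof.
move=> kh; rewrite /excess /offset.
have -> : \sum_j slope k h j * (q - c) 0 j = dotp (val h).1 (q - c) / scale k h.
  by rewrite /dotp mulr_suml; apply: eq_bigr => j _; rewrite mulrAC.
by rewrite dotpBr -mulrBl; congr (_ / _); lra.
Qed.

(* With y the grid point, w = slope h + (q - c) - y and w' = slope h' + (q - c)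
   - y, completing the square bounds the loss of excess by (|w|^2 - |w'|^2)/2. *)
Lemma excess_le k h h' q : in_cell k h -> in_cell k h' ->
  cost k h' <= cost k h ->
  excess k h q <= excess k h' q +
    (\sum_j (slope k h (lift k.1.1 j) + (q - c) 0 (lift k.1.1 j)
             - grid (k.2 j)) ^+ 2) / 2.
Proof.
move=> kh kh'; rewrite /cost /excess !(@bigD1_ord _ _ _ _ k.1.1)//= !slope_dominant//.
set p := _ * (q - c) 0 _.
set A := \sum_j _; set B := \sum_j _; set S := \sum_j _; set S' := \sum_j _.
set W := \sum_j _.
suff : S - S' <= W / 2 + A / 2 - B / 2 by lra.
rewrite /S /S' /W /A /B !mulr_suml -sumrB -big_split -sumrB /=.
apply: ler_sum => j _.
set u := slope k h _; set u' := slope k h' _; set x := (q - c) 0 _.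
set y := grid _.
have := sqr_ge0 (u' - y + x); nra.
Qed.

End Sketch.

Lemma grid_dense {R : realType} {N : nat} (y : R) : (0 < N)%N -> `|y| <= 2 ->
  exists m : 'I_N.+1, (y - grid (R := R) m) ^+ 2 <= (4 / N%:R) ^+ 2.
Proof.
move=> N0; rewrite ler_norml => /andP[y1 y2].
have N0' : 0 < N%:R :> R by rewrite ltr0n.
have step0 : 0 < 4 / N%:R :> R by rewrite divr_gt0.
pose u := (y + 2) / (4 / N%:R).
have u0 : 0 <= u by apply: divr_ge0; [lra|exact: ltW].
(* Rounding down gives index [N] at [y = 2], the last grid point. *)
have uN : (Num.truncn u < N.+1)%N.
  rewrite ltnS truncn_le_nat -[N.+1%:R]natr1 /u ltr_pdivrMr//.
  apply: (@lt_le_trans _ _ (4 + 4 / N%:R)); first lra.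
  by rewrite [leRHS]mulrDl mul1r [N%:R * _]mulrC divfK ?gt_eqF.
exists (Ordinal uN); rewrite /grid/=.
have /andP[] := truncn_itv u0; rewrite -[_.+1%:R]natr1.
have -> : y = u * (4 / N%:R) - 2 by rewrite divfK ?gt_eqF//; lra.
set t := (Num.truncn u)%:R; set w := 4 / N%:R => tu ut.
have -> : u * w - 2 - (t * w - 2) = (u - t) * w by lra.
rewrite exprMn ler_piMl ?sqr_ge0// expr_le1//; lra.
Qed.

(** * The streaming algorithm: correctness and memory *)

Section Algorithm.
Context {R : realType} {d : nat}.
Implicit Types (eps : R) (c q : 'rV[R]_d.+1).

Lemma memory_rcons (A : streaming_algorithm R d.+1) s h :
  memory A (rcons s h) = update A (size s) (memory A s) h.
Proof.
rewrite /memory -cats1 foldl_cat/=; congr (update A _ _ h).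
by elim/last_ind: s => // s h' IHs; rewrite -cats1 foldl_cat/= IHs size_cat addn1.
Qed.

(** Chosen so that [N ^ 2 >= 8 d / eps]: an error of [4 / N] in each of [d] coordinates then costs
    at most [d (4 / N) ^ 2 / 2 <= eps]. *)
Definition resolution eps : nat := (Num.truncn (Num.sqrt (8 * d%:R / eps))).+1.

(** The first two tests reflect that the polyhedron lies in the unit ball around [c]; the second
    also keeps the target of the grid search in range. *)
Definition accepts eps c (S : seq (hyperplane R d.+1)) q : bool :=
  [&& eps <= 1, enorm (q - c) <= 1 &
    all (fun h => dotp (val h).1 q + eps * enorm (val h).1 <= (val h).2) S].

(** For [eps > 1] every query is rejected, so storing nothing is safe; in dimension at least 2 the
    size bound tends to 0 there. *)
Definition sketch_step eps c L : seq (hyperplane R d.+1) :=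
  if eps <= 1 then sketch (N := resolution eps) c L else [::].

Lemma sketch_step_sub eps c L : {subset sketch_step eps c L <= L}.
Proof. by rewrite /sketch_step; case: ifP => // _; exact: sketch_sub. Qed.

Definition sketching eps c : streaming_algorithm R d.+1 :=
  {| update := fun _ S h => sketch_step eps c (h :: S);
     answer := fun _ => accepts eps c;
     update_sub := fun _ S h => sketch_step_sub eps c (h :: S) |}.

(** Whatever is dropped leaves a half-space of the same cell at no greater cost; transitivity
    carries this along the stream. *)
Lemma memory_covers eps c s h (k : cell (d := d) (N := resolution eps)) :
  eps <= 1 -> h \in s -> in_cell k h ->
  exists2 h', h' \in memory (sketching eps c) s
    & in_cell k h' /\ cost c k h' <= cost c k h.
Proof.
move=> eps1; elim/last_ind: s => // s h0 IHs.
rewrite mem_rcons in_cons memory_rcons /= /sketch_step eps1.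
set L := _ :: _ => hs kh.
have [h1 h1L [kh1 h1h]] :
    exists2 h', h' \in L & in_cell k h' /\ cost c k h' <= cost c k h.
  case/orP: hs => [hs0|/IHs/(_ kh)[h' h's ?]].
    by exists h0; rewrite ?mem_head//; move: kh; rewrite (eqP hs0).
  by exists h' => //; rewrite in_cons h's orbT.
have [h2 h2L [kh2 h21]] := sketch_min c k h1 L h1L kh1.
by exists h2 => //; split=> //; apply: le_trans h21 h1h.
Qed.

Lemma memory_sub eps c s : {subset memory (sketching eps c) s <= s}.
Proof.
elim/last_ind: s => // s h0 IHs h.
rewrite memory_rcons => /update_sub; rewrite mem_rcons !in_cons.
by case: (h == h0) => //= /IHs.
Qed.

Lemma resolution_loss eps : 0 < eps ->
  d%:R * (4 / (resolution eps)%:R) ^+ 2 / 2 <= eps :> R.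
Proof.
move=> eps0; have N0 : 0 < (resolution eps)%:R :> R by rewrite ltr0n.
have : 8 * d%:R / eps <= (resolution eps)%:R ^+ 2.
  rewrite -[leLHS]sqr_sqrtr; last by rewrite divr_ge0 ?mulr_ge0// ltW.
  by rewrite lerXn2r ?nnegrE ?sqrtr_ge0// ?ltW// /resolution truncnS_gt.
rewrite ler_pdivrMr// => dN.
have -> : d%:R * (4 / (resolution eps)%:R) ^+ 2 / 2
        = 8 * d%:R / (resolution eps)%:R ^+ 2 :> R.
  by field; rewrite gt_eqF.
by rewrite ler_pdivrMr ?exprn_gt0// [leRHS]mulrC.
Qed.

Lemma accepts_sound eps c s q : 0 < eps ->
  accepts eps c (memory (sketching eps c) s) q -> polyhedron s q.
Proof.
move=> eps0 /and3P[eps1 qc /allP mem_deep] h hs; rewrite /halfspace/= leNgt.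
apply/negP => hq.
have [i [b ib]] := in_cell_exists (N := resolution eps) h.
pose T := 'I_(resolution eps).+1.
(* [slope] reads only [i] and [b], so [ord0] is a placeholder until the grid point is chosen. *)
have Tex j : exists m : T, (slope ((i, b), [ffun=> ord0 : T]) h (lift i j)
    + (q - c) 0 (lift i j) - grid m) ^+ 2 <= (4 / (resolution eps)%:R) ^+ 2.
  apply: grid_dense => //; apply: le_trans (ler_normD _ _) _.
  apply: (@le_trans _ _ (1 + 1)); last lra.
  by rewrite lerD ?slope_le1//; apply: le_trans (coord_le_enorm _ _) qc.
pose k : cell (d := d) := ((i, b), [ffun j => projT1 (cid (Tex j))]).
have kh : in_cell k h by exact: ib.
have [h' h'm [kh' hh']] := memory_covers eps c s h k eps1 hs kh.
have := excess_le c k h h' q kh kh' hh'.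
set W := \sum_j _ => loss.
have W_le : W / 2 <= eps.
  apply: le_trans (resolution_loss _ eps0); rewrite ler_pM2r ?invr_gt0//.
  apply: (@le_trans _ _ (\sum_(j < d) (4 / (resolution eps)%:R) ^+ 2)).
    apply: ler_sum => j _; rewrite ffunE; exact: projT2 (cid (Tex j)).
  by rewrite sumr_const card_ord [leRHS]mulr_natl.
have h_gt0 : 0 < excess c k h q.
  by rewrite excessE// divr_gt0 ?subr_gt0 ?scale_gt0.
(* [scale] is at most the Euclidean norm of the normal, so the margin [eps] survives
   normalization. *)
have : excess c k h' q + eps <= 0.
  rewrite excessE// -lerBrDr sub0r ler_pdivrMr ?scale_gt0//.
  have := mem_deep _ h'm; have := scale_le_enorm _ _ kh'.
  by rewrite -(ler_pM2l eps0); lra.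
lra.
Qed.

Lemma accepts_complete eps c s q : 0 < eps -> polyhedron s `<=` unit_ball c ->
  (eps%:E <= edistance q (boundary (polyhedron s)))%E -> polyhedron s q ->
  accepts eps c (memory (sketching eps c) s) q.
Proof.
move=> eps0 sc q_far sq.
have deep z : enorm (q - z) < eps -> polyhedron s z.
  exact: edistance_boundary_ge q_far sq.
apply/and3P; split; last first.
- apply/allP => h /memory_sub hs; apply: halfspace_deep eps0 _ => z /deep.
  exact.
- exact: sc.
rewrite leNgt; apply/negP => eps1.
(* If [eps > 1], then [1 < t < eps]: moving [q] by [t] along a coordinate axis away from [c] stays
   in the polyhedron but leaves the unit ball. *)
pose t := (1 + eps) / 2.
pose sg : R := (-1) ^+ ((q - c) 0 ord0 < 0)%R.
pose z := q + (sg * t) *: delta_mx 0 ord0.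
have delta1 : enorm (delta_mx 0 ord0 : 'rV[R]_d.+1) = 1.
  rewrite /enorm /dotp (bigD1 ord0)//= big1 ?addr0.
    by rewrite !mxE !eqxx mulr1 sqrtr1.
  by move=> j /negPf j0; rewrite !mxE j0 mulr0.
have zs : polyhedron s z.
  apply: deep; rewrite /z opprD addrA subrr add0r enormN enormZ delta1 mulr1.
  by rewrite normrM normr_sign mul1r ger0_norm /t; lra.
have := le_trans (coord_le_enorm _ ord0) (sc _ zs).
have -> : (z - c) 0 ord0 = sg * (`|(q - c) 0 ord0| + t).
  rewrite mulrDr -realEsign ?num_real//.
  by rewrite /z !mxE !eqxx /= mulr1; ring.
rewrite normrM normr_sign mul1r ger0_norm /t.
  by have := normr_ge0 ((q - c) 0 ord0); lra.
by rewrite addr_ge0//; lra.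
Qed.

(** The first factor counts dominant coordinates and signs; the second bounds the grid, using
    [2 <= 2 / sqrt eps] for [eps <= 1]. *)
Definition size_constant : R :=
  (d.+1 * 2)%:R * (Num.sqrt (8 * d%:R) + 2) ^+ d.

Lemma size_memory eps c s : 0 < eps ->
  (size (memory (sketching eps c) s))%:R
    <= size_constant / eps `^ ((d.+1%:R - 1) / 2).
Proof.
move=> eps0; have K0 : 0 <= size_constant.
  by rewrite mulr_ge0// exprn_ge0// addr_ge0// sqrtr_ge0.
case/lastP: s => [|s h]; first by rewrite divr_ge0 ?powR_ge0.
rewrite memory_rcons/= /sketch_step; case: ifP => [eps1|_]; last first.
  by rewrite divr_ge0 ?powR_ge0.
apply: (@le_trans _ _ ((d.+1 * 2 * (resolution eps).+1 ^ d)%:R)).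
  by rewrite ler_nat size_sketch.
have s0 : 0 < Num.sqrt eps by rewrite sqrtr_gt0.
have s1 : Num.sqrt eps <= 1 by rewrite -[leRHS]sqrtr1 ler_wsqrtr.
rewrite -[d.+1%:R]natr1 addrK [_ / 2]mulrC powRrM powR12_sqrt; last exact: ltW.
rewrite powR_mulrn ?sqrtr_ge0// natrM natrX -mulrA -exprVn -exprMn ler_wpM2l//.
rewrite lerXn2r ?nnegrE//.
have -> : (resolution eps).+1%:R
    = (Num.truncn (Num.sqrt (8 * d%:R / eps)))%:R + 2 :> R.
  by rewrite -natrD addn2.
rewrite [leRHS]mulrDl lerD//.
  rewrite -sqrtrV; last exact: ltW.
  by rewrite -sqrtrM ?mulr_ge0// truncn_le sqrtr_ge0.
by rewrite -[leLHS]mulr1 ler_wpM2l// invf_ge1.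
Qed.

End Algorithm.

Theorem corollary16 (R : realType) (d : nat) (d_gt0 : (0 < d)%N) :
  exists (A : R -> 'rV[R]_d -> streaming_algorithm R d) (C : R),
  forall (eps : R) (c : 'rV[R]_d) (n : nat) (s : seq (hyperplane R d)),
    0 < eps -> (2 <= n)%N -> (size s <= n)%N ->
    polyhedron s `<=` unit_ball c ->
    (forall k : nat, (k <= size s)%N ->
       (size (memory (A eps c) (take k s)))%:R
         <= C * (ln (n%:R : R) ^+ d / eps `^ ((d%:R - 1) / 2)))
    /\ (forall q : 'rV[R]_d,
          (eps%:E <= edistance q (boundary (polyhedron s)))%E ->
          output (A eps c) s q <-> polyhedron s q).
Proof.
case: d d_gt0 => // d _.
(* The memory bound has no logarithm; since [n >= 2], dividing by [ln 2 ^+ d.+1] absorbs the factor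
   [ln n ^+ d.+1]. *)
exists sketching, (size_constant (d := d) / ln 2 ^+ d.+1).
move=> eps c n s eps0 n2 _ sc; split=> [k _|q q_far]; last first.
  by split; [exact: accepts_sound|exact: accepts_complete].
apply: le_trans (size_memory eps c _ eps0) _.
have ln2 : 0 < ln 2 :> R by rewrite ln_gt0// ltr1n.
rewrite mulrA ler_wpM2r ?invr_ge0 ?powR_ge0//.
rewrite mulrAC ler_pdivlMr ?exprn_gt0// ler_wpM2l//.
  by rewrite mulr_ge0// exprn_ge0// addr_ge0// sqrtr_ge0.
rewrite lerXn2r ?nnegrE ?ln_ge0 ?ler1n ?(ltn_trans _ n2)//.
by rewrite ler_ln ?posrE ?ltr0n ?ler_nat// (ltn_trans _ n2).
Qed.
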